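(* Let $X$ be a locally convex Hausdorff topological vector space, let $g,h:X\to\overline{\mathbb R}$ be proper generalized polyhedral convex functions, and let $C\subset X$ be a nonempty generalized polyhedral convex set such that $C\subset\mathrm{dom}\,g$ and $C\subset\mathrm{int}(\mathrm{dom}\,h)$. Let $\mathcal S_{1a}$ be the local solution set of the problem of minimizing $f(x):=g(x)-h(x)$ over $x\in C$. Then every connected component of $\mathcal S_{1a}$ is a union of finitely many semi-closed generalized polyhedral convex subsets of $C$, and the function $f=g-h$ has a constant value on the component.
   Context: $\overline{\mathbb R}=\mathbb R\cup\{\pm\infty\}$. $\mathrm{dom}\,\varphi=\{x\mid\varphi(x)<+\infty\}$, $\mathrm{epi}\,\varphi=\{(x,\alpha)\in X\times\mathbb R\mid x\in\mathrm{dom}\,\varphi,\ \varphi(x)\le\alpha\}$; $\varphi$ is proper if $\mathrm{dom}\,\varphi\ne\emptyset$ and $\varphi>-\infty$ everywhere; $\mathrm{int}$ denotes interior. A subset of a locally convex Hausdorff topological vector space $Z$ is generalized polyhedral convex if it has the form $\{z\in L\mid\langle z_k^*,z\rangle\le\alpha_k,\ k=1,\dots,p\}$ with $L\subset Z$ a closed affine subspace, $z_k^*\in Z^*$ (the topological dual), $\alpha_k\in\mathbb R$. A function $\varphi:X\to\overline{\mathbb R}$ is generalized polyhedral convex if $\mathrm{epi}\,\varphi$ is a generalized polyhedral convex set in $X\times\mathbb R$. A semi-closed generalized polyhedral convex subset of $C$ is a set of the form $P\cap O$, where $P\subset C$ is a generalized polyhedral convex set and $O\subset C$ is a convex set which is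 open in the relative topology of $C$. $\mathcal S_{1a}$ is the set of $\bar x\in C$ for which there is a neighborhood $U$ of $\bar x$ with $f(\bar x)\le f(x)$ for all $x\in C\cap U$. Connected components of $\mathcal S_{1a}$ are its maximal connected subsets, with respect to the topology induced from $X$. *)

(* Defs.v *)
From HB Require Import structures.
From mathcomp Require Import all_boot all_order all_algebra.
From mathcomp Require Import all_classical all_reals all_analysis.

Set Implicit Arguments.
Unset Strict Implicit.
Unset Printing Implicit Defensive.

Import Order.TTheory GRing.Theory Num.Theory.
Import numFieldTopology.Exports.

Local Open Scope classical_set_scope.
Local Open Scope ring_scope.

Section ConvexSets.
Context {R : realType}.

(* set0 counts as affine. This does not enlarge the class of generalized
   polyhedral convex sets: set0 is also {z | <0, z> <= -1}. *)
Definition affine_subspace (Z : lmodType R) (L : set Z) : Prop :=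
  forall (x y : Z) (t : R), L x -> L y -> L ((1 - t) *: x + t *: y).

Definition gen_polyhedral_convex (Z : tvsType R) (D : set Z) : Prop :=
  exists (L : set Z) (p : nat) (zs : 'I_p -> {linear Z -> R^o})
    (alpha : 'I_p -> R),
    [/\ closed L, affine_subspace L, forall k, continuous (zs k) &
        D = [set z | L z /\ forall k, zs k z <= alpha k]].

Context {X : tvsType R}.

Definition semi_closed_gen_polyhedral_convex (C D : set X) : Prop :=
  exists P O : set X,
    [/\ gen_polyhedral_convex P, P `<=` C,
        convex_set O, (exists2 V, open V & O = C `&` V) &
        D = P `&` O].

End ConvexSets.

Section ConvexFunctions.
Context {R : realType} {X : tvsType R}.
Implicit Type phi : X -> \bar R.

Definition edom phi : set X := [set x | (phi x < +oo)%E].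

Definition epi phi : set (X * R^o) :=
  [set xa | edom phi xa.1 /\ (phi xa.1 <= (xa.2 : R)%:E)%E].

Definition proper_fun phi : Prop := edom phi !=set0 /\ forall x, (-oo < phi x)%E.

Definition gen_polyhedral_convex_fun phi : Prop :=
  gen_polyhedral_convex (epi phi).

Definition local_solutions (C : set X) phi : set X :=
  [set xbar | C xbar /\ exists2 U, nbhs xbar U &
    forall x, (C `&` U) x -> (phi xbar <= phi x)%E].

End ConvexFunctions.

(* The library's connected_component is a union of connected subsets; these
   unions are exactly the nonempty maximal connected subsets. *)
Lemma connected_component_maximal (T : topologicalType) (S K : set T) :
  (exists2 x, S x & K = connected_component S x) <->
  [/\ K !=set0, K `<=` S, connected K &
      forall K', K' `<=` S -> connected K' -> K `<=` K' -> K' = K].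
Proof.
split=> [[x Sx ->]|[[x Kx] KS Kc Kmax]].
  split.
  - by exists x; exact: connected_component_refl.
  - exact: connected_component_sub.
  - exact: component_connected.
  - move=> K' K'S K'c KK'; apply/seteqP; split=> //.
    by apply: connected_component_max => //; apply/KK'/connected_component_refl.
have Sx := KS _ Kx; exists x => //; apply/esym/Kmax.
- exact: connected_component_sub.
- exact: component_connected.
- exact: connected_component_max.
Qed.

(* Main.v *)
From HB Require Import structures.
Require Import Defs.
From mathcomp Require Import all_boot all_order all_algebra.
From mathcomp Require Import all_classical all_reals all_analysis.
From mathcomp Require Import lra.

Set Implicit Arguments.
Unset Strict Implicit.
Unset Printing Implicit Defensive.

Import Order.TTheory GRing.Theory Num.Theory.
Import numFieldTopology.Exports.

Local Open Scope classical_set_scope.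
Local Open Scope ring_scope.

(** Why the theorem is true.

    A proper generalized polyhedral convex function is, on its domain, the
    maximum of finitely many continuous affine forms
    ([gen_polyhedral_convex_fun_max]).  Hence on C, which is cut out of an
    affine subspace by forms c_k <= 0, one has g = max_i g_i and h = max_j h_j.
    Consider the finite family of all c_k, g_i - g_i' and h_j - h_j'.  Recording
    which members of the family are negative at a point x of C tells which
    constraints are active at x and which g_i and h_j attain the maximum there.
    The points of C with a given record form a cell: a generalized polyhedral
    convex set (the conditions that some forms be nonnegative) intersected with
    a convex relatively open one (the conditions that the others be negative).

    Near x, the feasible directions and the increments of g and h depend only on
    the active constraints and the active forms, and these increments are
    positively homogeneous in the direction.  Local minimality is therefore the
    same for all points of a cell ([local_minimizers_sgn_invariant]), so the local
    solution set is a union of cells.  Cells are convex, hence connected, so a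
    connected component contains every cell that it meets
    ([connected_component_cells]).

    For the value of f: if x and y are local minimizers and y is close to x,
    then a form h_j active at y is also active at x, so f lies below its chord
    on the segment from y to x, and the local minimality of y gives
    f y <= f x; the reverse inequality is the local minimality of x.  So f is
    locally constant on the local solution set
    ([local_minimizers_locally_constant]), and constant on its components. *)

(** * Continuous affine forms *)

Section AffineForms.
Context {R : realType} {X : tvsType R}.
Implicit Types (q : X -> R) (x y z : X) (t : R).

Definition affine_form q := exists (u : {linear X -> R^o}) (b : R),
  continuous u /\ forall x, q x = u x + b.

Lemma affine_form_cst b : affine_form (fun _ => b).
Proof.
exists (\0 : {linear X -> R^o}), b; split; last by move=> x; rewrite /= add0r.
by move=> x; exact: cvg_cst.
Qed.

Lemma affine_formB q q' :
  affine_form q -> affine_form q' -> affine_form (fun x => q x - q' x).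
Proof.
move=> [u [b [uc qE]]] [u' [b' [u'c q'E]]].
exists (u \- u' : {linear X -> R^o}), (b - b'); split.
  by move=> x; apply: cvgB; [exact: uc|exact: u'c].
by move=> x; rewrite /= qE q'E opprD addrACA.
Qed.

Lemma affine_formZ a q : affine_form q -> affine_form (fun x => a * q x).
Proof.
move=> [u [b [uc qE]]].
exists (a \*: u : {linear X -> R^o}), (a * b); split.
  by move=> x; apply: cvgZr; exact: uc.
by move=> x; rewrite /= qE mulrDr.
Qed.

Lemma affine_formN q : affine_form q -> affine_form (fun x => - q x).
Proof.
move=> qf; have := affine_formB (affine_form_cst 0) qf.
by under eq_fun do rewrite sub0r.
Qed.

Lemma affine_form_line q x y z t :
  affine_form q -> q (x + t *: (z - y)) = q x + t * (q z - q y).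
Proof.
move=> [u [b [_ qE]]]; rewrite !qE linearD linearZ linearB /=.
rewrite /GRing.scale /=; lra.
Qed.

Lemma affine_form_continuous q : affine_form q -> continuous (q : X -> R^o).
Proof.
move=> [u [b [uc qE]]] x; have -> : q = fun x => u x + b by apply/funext.
by apply: cvgD; [exact: uc|exact: cvg_cst].
Qed.

Lemma open_affine_form_lt0 q : affine_form q -> open [set x | q x < 0].
Proof.
move=> /affine_form_continuous qc.
by apply: (@open_comp _ R^o q [set r | r < 0]) => [x _|]; [exact: qc|exact: open_lt].
Qed.

End AffineForms.

(** * Segments and convexity *)

Section Segments.
Context {R : realType} {X : tvsType R}.
Implicit Types (x y z v : X) (t : R) (D L : set X).

(** The point x + t (z - y) is the midpoint of x + 2t (z - x) and
    x - 2t (y - x), which lie on lines through two points of L. *)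
Lemma affine_subspace_line L x y z t : affine_subspace L ->
  L x -> L y -> L z -> L (x + t *: (z - y)).
Proof.
move=> La Lx Ly Lz.
have lineE a b s : a + s *: (b - a) = (1 - s) *: a + s *: b :> X.
  by rewrite scalerBr scalerBl scale1r addrA addrAC.
have -> : x + t *: (z - y) = (1 - 2^-1) *: (x + (2 * t) *: (z - x)) +
    2^-1 *: (x + (- (2 * t)) *: (y - x)).
  rewrite [(1 - _) *: _]scalerDr [2^-1 *: _]scalerDr !scalerA addrACA.
  rewrite -scalerDl subrK scale1r; congr (x + _).
  rewrite (_ : (1 - 2^-1) * (2 * t) = t); last lra.
  rewrite (_ : 2^-1 * (- (2 * t)) = - t); last lra.
  by rewrite scaleNr -scalerBr opprB addrA subrK.
rewrite !lineE.
by apply: (La); exact: La.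
Qed.

Lemma convex_setP D : convex_set D <->
  forall x y t, 0 <= t <= 1 -> D x -> D y -> D (x + t *: (y - x)).
Proof.
have convE x y (k : {i01 R}) :
    conv k (x : convex_lmodType X) y = y + k%:num *: (x - y).
  rewrite -[LHS]/(k%:num *: x + (1 - k%:num) *: y :> X).
  by rewrite scalerBl scale1r scalerBr addrCA.
split=> [Dc x y t /andP[t0 t1] Dx Dy|Dc x y t].
  have := Dc y x (Itv01 t0 t1); rewrite convE => h.
  by apply/set_mem/h; apply/mem_set.
move=> /set_mem Dx /set_mem Dy; apply/mem_set; rewrite convE.
by apply: Dc => //; apply/andP; split.
Qed.

Lemma continuous_line x v : continuous (fun t : R^o => x + t *: v).
Proof.
move=> t; apply: (@continuous2_cvg _ X X X _ _ _ _ (@GRing.add X)).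
- exact: (@add_continuous X (x, t *: v)).
- exact: cvg_cst.
apply: (@continuous2_cvg _ R^o X X _ _ _ _ (@GRing.scale R X)).
- exact: (@scale_continuous R X (t, v)).
- exact: cvg_id.
- exact: cvg_cst.
Qed.

Lemma near_line x v (P : set X) :
  (\forall y \near x, P y) -> \forall t \near (0:R)^'+, P (x + t *: v).
Proof.
move=> Px; apply: (@cvg_within _ (nbhs (0 : R))).
by apply: (@continuous_line x v 0); rewrite scale0r addr0.
Qed.

Lemma convex_set_connected D : convex_set D -> connected D.
Proof.
move=> /convex_setP Dc.
have [->|/set0P[x Dx]] := eqVneq D set0; first exact: connected0.
suff -> : D = connected_component D x by exact: component_connected.
apply/seteqP; split; last exact: connected_component_sub.
move=> y Dy; pose p (t : R) := x + t *: (y - x).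
apply: (@connected_component_max _ _ (p @` `[0, 1])).
- by exists 0; rewrite /p ?scale0r ?addr0 //= in_itv /= lexx ler01.
- by move=> _ [t t01 <-]; apply: Dc => //; move: t01; rewrite /= in_itv.
- apply: connected_continuous_connected; first exact: segment_connected.
  apply: continuous_subspaceT; exact: continuous_line.
- by exists 1; rewrite /p ?scale1r ?subrKC //= in_itv /= lexx ler01.
Qed.

End Segments.

(** * Generalized polyhedral convex sets *)

Section Polyhedra.
Context {R : realType} {X : tvsType R}.
Implicit Types (D : set X).

(** Arbitrary finite index types and affine forms compared with 0 make it
    possible to merge systems of inequalities without renumbering. *)
Lemma gen_polyhedral_convexP D : gen_polyhedral_convex D <->
  exists (L : set X) (K : finType) (c : K -> X -> R),
    [/\ closed L, affine_subspace L, forall k, affine_form (c k) &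
        D = [set x | L x /\ forall k, c k x <= 0]].
Proof.
split=> [[L [p [zs [al [Lc La zc ->]]]]]|[L [K [c [Lc La cf ->]]]]].
  exists L, 'I_p, (fun k x => zs k x - al k); split=> //.
    by move=> k; exists (zs k), (- al k); split.
  by apply/seteqP; split=> x /= [Lx h]; split=> // k; have := h k; rewrite subr_le0.
have [u /choice[b ub]] := choice cf.
exists L, #|K|, (fun i => u (enum_val i)), (fun i => - b (enum_val i)).
split=> // [k|]; first by have [] := ub (enum_val k).
apply/seteqP; split=> x /= [Lx h]; split=> // k.
  by have [_ cE] := ub (enum_val k); rewrite -subr_le0 opprK -cE.
by have [_ ->] := ub k; have := h (enum_rank k); rewrite enum_rankK -subr_le0 opprK.
Qed.

Lemma gen_polyhedral_convex_setI D (M : finType) (q : M -> X -> R) :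
  gen_polyhedral_convex D -> (forall m, affine_form (q m)) ->
  gen_polyhedral_convex (D `&` [set x | forall m, q m x <= 0]).
Proof.
move=> /gen_polyhedral_convexP[L [K [c [Lc La cf ->]]]] qf.
apply/gen_polyhedral_convexP.
exists L, (K + M)%type, (fun s => match s with inl k => c k | inr m => q m end).
split=> //; first by case.
apply/seteqP; split=> x /=.
  by move=> [[Lx cx] qx]; split=> // -[].
move=> [Lx h]; split; [split=> // k|move=> m].
- exact: (h (inl k)).
- exact: (h (inr m)).
Qed.

Lemma affine_form_le0_segment (q : X -> R) x y t : affine_form q -> 0 <= t <= 1 ->
  q x <= 0 -> q y <= 0 -> q (x + t *: (y - x)) <= 0.
Proof. move=> qf ? ? ?; rewrite affine_form_line//; nra. Qed.

Lemma gen_polyhedral_convex_convex D : gen_polyhedral_convex D -> convex_set D.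
Proof.
move=> /gen_polyhedral_convexP[L [K [c [Lc La cf ->]]]].
apply/convex_setP => x y t t01 [Lx cx] [Ly cy]; split.
  exact: affine_subspace_line.
by move=> k; apply: affine_form_le0_segment.
Qed.

End Polyhedra.

                                                 

Section Cells.
Context {R : realType} {X : tvsType R} {M : finType} (q : M -> X -> R).
Context (q_affine : forall m, affine_form (q m)).
Implicit Types (C S : set X) (A : {set M}) (x y : X).

(** This relation goes from a point to the points near it, since strict
    inequalities are open conditions ([near_sgn_le]). Two points related both
    ways lie in the same cell. *)
Definition sgn_le x y := forall m, q m x < 0 -> q m y < 0.

Definition cell C A : set X := [set x | C x /\ forall m, (q m x < 0) = (m \in A)].

Definition cell_of x : {set M} := [set m | q m x < 0].

Lemma cell_cell_of C x : C x -> cell C (cell_of x) x.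
Proof. by move=> Cx; split=> // m; rewrite inE. Qed.

Lemma near_sgn_le x : \forall y \near x, sgn_le x y.
Proof.
apply: filter_forall => m; case: (ltP (q m x) 0) => [qx|_]; last exact: nearW.
apply: filterS (open_nbhs_nbhs _); last first.
  by split; [exact: (open_affine_form_lt0 (q_affine m))|exact: qx].
by move=> y /= qy _.
Qed.

Lemma cell_semi_closed C A :
  gen_polyhedral_convex C -> semi_closed_gen_polyhedral_convex C (cell C A).
Proof.
move=> Cp.
exists (C `&` [set x | forall m, (if m \in A then 0 else - q m x) <= 0]).
exists (C `&` [set x | forall m, m \in A -> q m x < 0]); split.
- apply: gen_polyhedral_convex_setI => // m.
  by case: (m \in A); [exact: affine_form_cst|exact: affine_formN].
- exact: subIsetl.
- apply/convex_setP => x y t t01 [Cx qx] [Cy qy]; split.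
    by move: x y t t01 Cx Cy {qx qy}; apply/convex_setP/gen_polyhedral_convex_convex.
  move=> m mA; rewrite affine_form_line//.
  by have := qx m mA; have := qy m mA; nra.
- exists [set x | forall m, m \in A -> q m x < 0].
  + rewrite openE => x /= qx; apply: filter_forall => m.
    case: (boolP (m \in A)) => [mA|_]; last exact: nearW.
    have : nbhs x [set y | q m y < 0].
      apply: open_nbhs_nbhs; split; last exact: qx.
      exact: open_affine_form_lt0 (q_affine m).
    exact: filterS.
  + by [].
- apply/seteqP; split=> x /=.
  + move=> [Cx qx]; split; split=> // m; have := qx m; case: (m \in A) => //.
    by move/negbT; rewrite -leNgt oppr_le0.
  + move=> [[Cx q1] [_ q2]]; split=> // m; case: ifP (q1 m) (q2 m) => // _.
      by move=> _; apply.
    by rewrite oppr_le0 ltNge => ->.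
Qed.

Lemma cell_connected C A : gen_polyhedral_convex C -> connected (cell C A).
Proof.
move=> Cp; apply/convex_set_connected/convex_setP => x y t t01 [Cx qx] [Cy qy].
split.
  by move: x y t t01 Cx Cy {qx qy}; apply/convex_setP/gen_polyhedral_convex_convex.
move=> m; rewrite affine_form_line//; move: (qx m) (qy m) t01.
by case: (m \in A) => [qx0 qy0 ?|/negbT + /negbT +]; rewrite -?leNgt => *;
  [|apply/negbTE; rewrite -leNgt]; nra.
Qed.

(** The hypothesis on S says that S is a union of cells. *)
Lemma connected_component_cells C S x0 : gen_polyhedral_convex C ->
  S `<=` C ->
  (forall x y, S x -> C y -> sgn_le x y -> sgn_le y x -> S y) ->
  S x0 ->
  exists (n : nat) (D : 'I_n -> set X),
    (forall i, semi_closed_gen_polyhedral_convex C (D i)) /\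
    connected_component S x0 = \bigcup_i D i.
Proof.
move=> Cp SC Sinv Sx0; set K := connected_component S x0.
have cellK x : K x -> cell C (cell_of x) `<=` K.
  move=> Kx; rewrite /K (same_connected_component Kx).
  have Sx := connected_component_sub Kx.
  apply: connected_component_max; first exact: cell_cell_of (SC _ Sx).
    move=> y [Cy qy]; apply: Sinv Sx Cy _ _ => m; have := qy m; rewrite inE => <-//.
  exact: cell_connected.
(* Records of cells that do not meet K are redirected to the cell of x0, so
   that the family is indexed by all of {set M}. *)
pose B (A : {set M}) := if `[< exists2 x, K x & A = cell_of x >] then A else cell_of x0.
exists #|{set M}|, (fun i => cell C (B (enum_val i))); split.
  by move=> i; exact: cell_semi_closed.
apply/seteqP; split=> x.
  move=> Kx; exists (enum_rank (cell_of x)) => //; rewrite enum_rankK /B.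
  rewrite ifT; last by apply/asboolP; exists x.
  exact/cell_cell_of/SC/(connected_component_sub Kx).
move=> [i _]; rewrite /B; case: ifPn => [/asboolP[y Ky ->]|_]; first exact: cellK.
exact/cellK/connected_component_refl.
Qed.

End Cells.

                                                               

Section MaxOfAffineForms.
Context {R : realType} {X : tvsType R}.

Definition local_minimizers (C : set X) (F : X -> R) : set X :=
  [set x | C x /\ exists2 U, nbhs x U & forall y, C y -> U y -> F x <= F y].

Definition max_on (I : Type) (C : set X) (g : I -> X -> R) (G : X -> R) :=
  forall x, C x -> (forall i, g i x <= G x) /\ exists i, G x = g i x.

Lemma max_on_segment (I : Type) C (g : I -> X -> R) G x y t :
  (forall i, affine_form (g i)) -> max_on C g G -> 0 <= t <= 1 ->
  C x -> C y -> C (x + t *: (y - x)) ->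
  G (x + t *: (y - x)) <= G x + t * (G y - G x).
Proof.
move=> gf gG t01 Cx Cy Cz; have [_ [i ->]] := gG _ Cz.
rewrite affine_form_line//.
have := (gG _ Cx).1 i; have := (gG _ Cy).1 i; nra.
Qed.

End MaxOfAffineForms.

Section DifferenceOfMaxima.
Context {R : realType} {X : tvsType R} {K I J : finType}.
Context (L : set X) (c : K -> X -> R) (g : I -> X -> R) (h : J -> X -> R).
Context (G H : X -> R).
Local Notation C := [set x | L x /\ forall k, c k x <= 0].
Context (L_affine : affine_subspace L).
Context (c_affine : forall k, affine_form (c k)).
Context (g_affine : forall i, affine_form (g i)).
Context (h_affine : forall j, affine_form (h j)).
Context (gG : max_on C g G).
Context (hH : max_on C h H).

Local Notation F := (fun x => G x - H x).

(** The affine forms whose signs determine the active constraints and the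
    active members of both maxima. *)
Definition comparisons (m : K + (I * I + J * J)) : X -> R :=
  match m with
  | inl k => c k
  | inr (inl (i, i')) => fun x => g i x - g i' x
  | inr (inr (j, j')) => fun x => h j x - h j' x
  end.

Lemma comparisons_affine m : affine_form (comparisons m).
Proof. by case: m => [k|[[i i']|[j j']]] //=; exact: affine_formB. Qed.

Notation "x <~ y" := (sgn_le comparisons x y) (at level 70).

(** A form that is inactive at x lies strictly below some other one; a strict
    inequality at x persists at y, so the form is inactive at y too. *)
Lemma active_sgn_le_g x y i : C x -> C y -> x <~ y -> G y = g i y -> G x = g i x.
Proof.
move=> Cx Cy xy Gy; have [gx [i' Gx]] := gG Cx.
apply/eqP; rewrite eq_le gx andbT leNgt; apply/negP; rewrite Gx => lt.
have := xy (inr (inl (i, i'))); rewrite /= !subr_lt0 -Gy => /(_ lt).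
by rewrite ltNge (gG Cy).1.
Qed.

Lemma active_sgn_le_h x y j : C x -> C y -> x <~ y -> H y = h j y -> H x = h j x.
Proof.
move=> Cx Cy xy Hy; have [hx [j' Hx]] := hH Cx.
apply/eqP; rewrite eq_le hx andbT leNgt; apply/negP; rewrite Hx => lt.
have := xy (inr (inr (j, j'))); rewrite /= !subr_lt0 -Hy => /(_ lt).
by rewrite ltNge (hH Cy).1.
Qed.

Local Notation local_min := (local_minimizers C F).

(** Let z in C be close to y. For small t > 0 the point x' = x + t (z - y) is
    feasible, because x and y have the same active constraints, and F x <= F x'.
    With i active at x' and j active at z, both are active at x and at y, and
    F x <= F x' yields 0 <= t (g_i z - G y) - t (h_j z - H y), which is at most
    t (F z - F y). *)
Lemma local_minimizers_sgn_invariant x y :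
  local_min x -> C y -> x <~ y -> y <~ x -> local_min y.
Proof.
move=> [Cx [U Ux Fmin]] Cy xy yx; split=> //.
exists [set z | y <~ z]; first exact: near_sgn_le comparisons_affine _.
move=> z Cz yz.
have : \forall t \near (0:R)^'+,
    [/\ 0 < t, U (x + t *: (z - y)) & x <~ (x + t *: (z - y))].
  near=> t; split; near: t.
  - exact: nbhs_right_gt.
  - exact: near_line.
  - exact/near_line/near_sgn_le/comparisons_affine.
move=> /filter_ex[t]; set x' := x + t *: (z - y) => -[t0 Ux' xx'].
have Cx' : C x'.
  (* A constraint inactive at x stays inactive at x'; one active at x is active
     at y, hence does not increase in the direction z - y. *)
  case: Cx Cy Cz => [Lx cx] [Ly cy] [Lz cz]; split; first exact: affine_subspace_line.
  move=> k; case: (ltP (c k x) 0) => [/(xx' (inl k))/ltW//|ckx].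
  have cky : 0 <= c k y.
    by rewrite leNgt; apply/negP => /(yx (inl k)); rewrite /= ltNge ckx.
  rewrite affine_form_line//; have := cx k; have := cz k; nra.
have [gx' [i Gx']] := gG Cx'.
have Gx := active_sgn_le_g Cx Cx' xx' Gx'.
have Gy := active_sgn_le_g Cy Cx yx Gx.
have [hz [j Hz]] := hH Cz.
have Hy := active_sgn_le_h Cy Cz yz Hz.
have Hx := active_sgn_le_h Cx Cy xy Hy.
have /= := Fmin _ Cx' Ux'.
have := (hH Cx').1 j; have := (gG Cz).1 i.
move: Gx'; rewrite (affine_form_line _ _ _ _ (g_affine i)) -Gx -Gy.
rewrite (affine_form_line _ _ _ _ (h_affine j)) -Hx -Hy -Hz.
nra.
Unshelve. all: by end_near. Qed.

(** A form h_j active at y is active at x, so at z = y + t (x - y) one has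
    H z >= h_j z = H y + t (H x - H y), while G is convex: thus
    F y <= F z <= F y + t (F x - F y), and F y <= F x. *)
Lemma local_minimizers_locally_constant x :
  local_min x -> \forall y \near x, local_min y -> F y = F x.
Proof.
move=> [Cx [U Ux Fmin]]; near=> y => -[Cy [V Vy Fminy]].
apply/eqP; rewrite eq_le; apply/andP; split; last by apply: Fmin => //; near: y.
have xy : x <~ y by near: y; exact: near_sgn_le comparisons_affine _.
have : \forall t \near (0:R)^'+, [/\ 0 < t, t <= 1 & V (y + t *: (x - y))].
  near=> t; split; near: t.
  - exact: nbhs_right_gt.
  - exact: nbhs_right_le.
  - exact: near_line.
move=> /filter_ex[t [t0 t1 Vz]].
have t01 : 0 <= t <= 1 by rewrite ltW.
have Cz : C (y + t *: (x - y)).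
  case: (Cx) (Cy) => [Lx cx] [Ly cy]; split; first exact: affine_subspace_line.
  by move=> k; exact: affine_form_le0_segment.
have /= := Fminy _ Cz Vz.
have := max_on_segment g_affine gG t01 Cy Cx Cz.
have [_ [j Hy]] := hH Cy; have Hx := active_sgn_le_h Cx Cy xy Hy.
have := (hH Cz).1 j; rewrite (affine_form_line _ _ _ _ (h_affine j)) -Hx -Hy.
nra.
Unshelve. all: by end_near. Qed.

End DifferenceOfMaxima.

(** * Locally constant functions on connected sets *)

(** The fibre over F x is open in K, and so is its complement. *)
Lemma connected_locally_constant (T : topologicalType) (V : Type) (S K : set T)
    (F : T -> V) :
  (forall x, S x -> \forall y \near x, S y -> F y = F x) ->
  connected K -> K `<=` S -> forall x y, K x -> K y -> F y = F x.
Proof.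
move=> Floc Kc KS x y Kx Ky.
pose W (P : set V) := interior [set z | S z -> P (F z)].
have WE (P : set V) z : K z -> W P z <-> P (F z).
  move=> Kz; have Sz := KS _ Kz; split.
    by move=> /nbhs_singleton; apply.
  by move=> PFz; apply: filterS (Floc _ Sz) => w Fw Sw /=; rewrite Fw.
suff KE : K `&` [set z | F z = F x] = K by move: Ky; rewrite -KE => -[].
apply: Kc; first by exists x.
- exists (W [set v | v = F x]); first exact: open_interior.
  by apply/seteqP; split=> z [Kz /= Fz]; split=> //; exact/(WE [set v | v = F x] _ Kz).
- exists (~` W [set v | v <> F x]); first exact/open_closedC/open_interior.
  apply/seteqP; split=> z [Kz].
    by move=> Fz; split=> // /(WE [set v | v <> F x] _ Kz).
  by move=> nW; split=> //=; apply: contrapT => Fz; apply/nW/(WE [set v | v <> F x] _ Kz).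
Qed.

(** * Functions with a generalized polyhedral convex epigraph *)

Section Epigraphs.
Context {R : realType} {X : tvsType R}.

Lemma affine_form_slice (c : X * R^o -> R) :
  affine_form c -> affine_form (fun x => c (x, 0)).
Proof.
move=> [u [b [uc cE]]].
have inj_linear : linear (fun x : X => (x, 0) : X * R^o).
  by move=> a x y; congr pair; rewrite /= /GRing.scale /= mulr0 addr0.
pose inj : {linear X -> (X * R^o)%type} :=
  HB.pack (fun x : X => (x, 0) : X * R^o) (GRing.isLinear.Build _ _ _ _ _ inj_linear).
exists (u \o inj : {linear X -> R^o}), b; split=> [x|x]; last exact: cE.
apply: (@continuous_comp _ _ _ inj u); last exact: uc.
apply: (@cvg_pair X X R^o (nbhs x) (nbhs x) (nbhs (0 : R^o)) _ _ _ id (cst 0)).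
  exact: cvg_id.
exact: cvg_cst.
Qed.

(** Write the epigraph as (x, a) in L, c_k (x, 0) + a b_k <= 0. The fibre over
    x in the domain is a half-line [r, +oo) with r = phi x. It is unbounded above,
    so b_k <= 0 for all k, and the whole line over x lies in L. Solving the
    inequalities with b_k < 0 for a gives the forms c_k (x, 0) / (- b_k) <= r.
    One of them must be an equality, since otherwise a could be decreased
    below r. *)
Lemma gen_polyhedral_convex_fun_max (phi : X -> \bar R) :
  proper_fun phi -> gen_polyhedral_convex_fun phi ->
  exists (I : finType) (g : I -> X -> R),
    (forall i, affine_form (g i)) /\ max_on (edom phi) g (fine \o phi).
Proof.
move=> [_ phi_gtNy] /gen_polyhedral_convexP[L [K [c [_ La cf epiE]]]].
pose b k := c k (0, 1) - c k (0, 0).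
have cE k x (a : R) : c k (x, a) = c k (x, 0) + a * b k.
  rewrite -(@affine_form_line _ _ (c k) (x, 0 : R^o) (0 : X, 0 : R^o) (0 : X, 1 : R^o) a)//.
  congr (c k _).
  congr pair; first by rewrite /= subr0 scaler0 addr0.
  by rewrite /= subr0 add0r /GRing.scale /= mulr1.
exists {k : K | b k < 0}, (fun k x => (- b (val k))^-1 * c (val k) (x, 0)); split.
  by move=> k; apply: affine_formZ; exact: affine_form_slice.
move=> x domx /=.
have [r phix] : exists r, phi x = r%:E.
  have : phi x \is a fin_num by rewrite fin_numE gt_eqF ?phi_gtNy ?lt_eqF.
  by move=> /fineK <-; eexists.
rewrite phix /=.
have epix (a : R) : (L (x, a) /\ forall k, c k (x, a) <= 0) <-> r <= a.
  have : epi phi (x, a) <-> r <= a.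
    by rewrite /epi /= phix lee_fin; split=> [[]|].
  by rewrite epiE.
have Lx (a : R) : L (x, a).
  have [Lr _] := (epix r).2 (lexx r).
  have r1 : r <= r + 1 by rewrite lerDl.
  have [Lr1 _] := (epix (r + 1)).2 r1.
  have := La _ _ (a - r) Lr Lr1; congr L; congr pair => /=.
    by rewrite -scalerDl subrK scale1r.
  by rewrite /GRing.scale /=; lra.
have b_le0 k : b k <= 0.
  rewrite leNgt; apply/negP => bk.
  have [_ /(_ k)] := (epix r).2 (lexx r); rewrite cE => cr.
  (* At this height the k-th inequality would read 1 <= 0. *)
  pose a := r + (1 - (c k (x, 0) + r * b k)) / b k.
  have ra : r <= a by rewrite lerDl; apply: divr_ge0; lra.
  have [_ /(_ k)] := (epix a).2 ra; rewrite cE /a mulrDl divfK ?gt_eqF//; lra.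
split.
  move=> [k bk] /=.
  have [_ /(_ k)] := (epix r).2 (lexx r); rewrite cE => ?.
  rewrite mulrC ler_pdivrMr; lra.
apply: contrapT => ng.
have : \forall e \near (0:R)^'+, 0 < e /\ forall k, c k (x, r - e) <= 0.
  near=> e; split; first by near: e; exact: nbhs_right_gt.
  near: e; apply: filter_forall => k.
  have [_ /(_ k)] := (epix r).2 (lexx r); rewrite cE => cr.
  have [bk|bk] := ltP (b k) 0; last first.
    have bk0 : b k = 0 by apply/eqP; rewrite eq_le b_le0 bk.
    by apply: nearW => e; rewrite cE; move: cr; rewrite bk0 !mulr0.
  have {}cr : c k (x, 0) + r * b k < 0.
    rewrite lt_neqAle cr andbT; apply/eqP => c0; apply: ng.
    exists (exist _ k bk) => /=.
    apply: (mulIf (lt0r_neq0 (_ : 0 < - b k))); first by rewrite oppr_gt0.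
    rewrite mulrAC mulVf ?mul1r; first by lra.
    by rewrite oppr_eq0 lt_eqF.
  have e0 : 0 < (c k (x, 0) + r * b k) / b k by rewrite nmulr_rgt0 ?invr_lt0.
  near=> e; rewrite cE mulrBl addrA subr_le0 -ler_ndivlMr//; near: e.
  exact: nbhs_right_le.
move=> /filter_ex[e [e0 ce]].
have : r <= r - e by apply/epix; split.
by lra.
Unshelve. all: by end_near. Qed.

End Epigraphs.

Theorem theorem4p6 (R : realType) (X : tvsType R)
    (X_hausdorff : hausdorff_space X)
    (g h : X -> \bar R) (C : set X)
    (g_proper : proper_fun g) (g_gpc : gen_polyhedral_convex_fun g)
    (h_proper : proper_fun h) (h_gpc : gen_polyhedral_convex_fun h)
    (C_neq0 : C !=set0) (C_gpc : gen_polyhedral_convex C)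
    (C_dom_g : C `<=` edom g) (C_int_dom_h : C `<=` interior (edom h)) :
  let f : X -> \bar R := fun x => (g x - h x)%E in
  let S1a : set X := local_solutions C f in
  forall x0 : X, S1a x0 ->
    let K : set X := connected_component S1a x0 in
    (exists (n : nat) (D : 'I_n -> set X),
        (forall i, semi_closed_gen_polyhedral_convex C (D i)) /\
        K = \bigcup_i D i) /\
    (exists c : \bar R, forall x, K x -> f x = c).
Proof.
move=> f S x0 Sx0 K.
have C_dom_h : C `<=` edom h := subset_trans C_int_dom_h (@interior_subset _ _).
have [I [gs [gs_affine g_max]]] := gen_polyhedral_convex_fun_max g_proper g_gpc.
have [J [hs [hs_affine h_max]]] := gen_polyhedral_convex_fun_max h_proper h_gpc.
have /gen_polyhedral_convexP[L [P [c [_ L_affine c_affine CE]]]] := C_gpc.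
pose G := fine \o g; pose H := fine \o h.
have gG : max_on [set x | L x /\ forall k, c k x <= 0] gs G.
  by rewrite -CE => x /C_dom_g; exact: g_max.
have hH : max_on [set x | L x /\ forall k, c k x <= 0] hs H.
  by rewrite -CE => x /C_dom_h; exact: h_max.
have fE x : C x -> f x = (G x - H x)%:E.
  move=> Cx; rewrite /f /G /H /= EFinB !fineK// fin_numE.
    by rewrite gt_eqF ?h_proper.2 ?lt_eqF ?C_dom_h.
  by rewrite gt_eqF ?g_proper.2 ?lt_eqF ?C_dom_g.
have SE : S = local_minimizers C (fun x => G x - H x).
  apply/seteqP; split=> x [Cx [U Ux fmin]].
  - split=> //; exists U => // y Cy Uy.
    by rewrite -lee_fin -!fE//; apply: fmin.
  - by split=> //; exists U => // y [Cy Uy]; rewrite !fE// lee_fin; exact: fmin.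
have SC : S `<=` C by move=> x [].
split.
  apply: (connected_component_cells (q := comparisons c gs hs)) => //.
    exact: comparisons_affine.
  move=> x y; rewrite SE CE; exact: local_minimizers_sgn_invariant.
exists (f x0) => x Kx.
have KS : K `<=` S := @connected_component_sub _ _ _.
rewrite !fE; [|exact: SC|exact/SC/KS]; congr EFin.
apply: (connected_locally_constant (S := S) (F := fun x => G x - H x)) KS _ _ _ Kx.
- move=> y; rewrite SE CE => Sy.
  exact: (local_minimizers_locally_constant L_affine c_affine gs_affine hs_affine gG hH).
- exact: component_connected.
- exact: connected_component_refl.
Qed.
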